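(* Let $\Bbbk$ be a field and let $G$ be a finite, simple, connected, nontrivial graph with edge ideal $I(G)$. The following are equivalent: (1) the LCM lattice $\mathcal{L}_{I(G)}$ is modular; (2) $\mathcal{L}_{I(G)}$ is geometric; (3) $\mathcal{L}_{I(G)}$ is upper semimodular; (4) $G$ has no two disjoint edges; (5) $G$ is isomorphic to $C_3$ or to $\operatorname{St}_n$ for some $n\ge 2$.
   Context: A graph is nontrivial if it has at least one edge. For a graph $G$ on vertex set $\{1,\ldots,n\}$, $I(G)=(x_ix_j\mid\{i,j\}\in E(G))\subseteq\Bbbk[x_1,\ldots,x_n]$. $C_3$ is the 3-cycle; $\operatorname{St}_n$ is the star graph with vertex set $\{1,\ldots,n\}$ and edges $\{1,i\}$ for $2\le i\le n$. The LCM lattice $\mathcal{L}_I$ of a monomial ideal $I$ is the set of least common multiples of subsets of its minimal monomial generators (the lcm of the empty set is $1$), ordered by divisibility; it is a finite lattice with join lcm. A finite lattice $L$ is graded if it has an order-preserving function $\operatorname{rk}:L\to\mathbb{Z}$ with $\operatorname{rk}(\hat 0)=0$ and $\operatorname{rk}(y)=\operatorname{rk}(x)+1$ whenever $y$ covers $x$. A graded lattice is upper semimodular (resp. modular) if $\operatorname{rk}(x)+\operatorname{rk}(y)\ge\operatorname{rk}(x\wedge y)+\operatorname{rk}(x\vee y)$ (resp. equality holds) for all $x,y$; these notions include being graded. A lattice is geometric if it is upper semimodular and atomic (every element is a join of atoms). *)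

(* Defs.v *)
From HB Require Import structures.
From mathcomp Require Import all_boot all_order all_algebra.
From mathcomp Require Import boolp mpoly.

Set Implicit Arguments.
Unset Strict Implicit.
Unset Printing Implicit Defensive.

Import Order.TTheory GRing.Theory.
Local Open Scope ring_scope.

Section FiniteLattices.
Local Open Scope order_scope.
Variables (d : Order.disp_t) (L : finTBLatticeType d).

Definition covers (x y : L) : Prop := x < y /\ forall z : L, ~~ (x < z < y).

Definition atom (a : L) : Prop := covers \bot a.

Definition atomic : Prop := forall x : L,
  exists2 s : seq L, {in s, forall a, atom a} & x = \join_(a <- s) a.

Definition is_rank (rk : L -> int) : Prop :=
  [/\ {homo rk : x y / x <= y >-> (x <= y)%R},
      rk \bot = 0%R
    & forall x y, covers x y -> rk y = (rk x + 1)%R].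

(* A rank function on a finite lattice is unique, so quantifying over it
   existentially in the next two definitions is harmless. *)
Definition upper_semimodular : Prop := exists2 rk : L -> int, is_rank rk &
  forall x y : L, (rk (x `&` y) + rk (x `|` y) <= rk x + rk y)%R.

Definition modular : Prop := exists2 rk : L -> int, is_rank rk &
  forall x y : L, (rk x + rk y = rk (x `&` y) + rk (x `|` y))%R.

Definition geometric : Prop := upper_semimodular /\ atomic.

End FiniteLattices.

Section MonomialIdeals.
Variables (k : fieldType) (n : nat).
Implicit Types (I : {mpoly k[n]} -> Prop) (s : seq 'X_{1..n}).

(* Membership in the ideal generated by the monomials of [s]. Coefficients are
   indexed by positions because [s] may have repetitions. *)
Definition monomial_ideal s (p : {mpoly k[n]}) : Prop :=
  exists c : nat -> {mpoly k[n]},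
    p = \sum_(i < size s) c i * 'X_[nth 0%MM s i].

(* [(u <= v)%MM] is divisibility of monomials, whereas [(u <= v)%O] on
   ['X_{1..n}] would be a monomial order. *)
Definition min_gen I (m : 'X_{1..n}) : Prop :=
  I 'X_[m] /\ forall u : 'X_{1..n}, I 'X_[u] -> (u <= m)%MM -> u = m.

Definition biglcm s : 'X_{1..n} := \big[@mlcm n/0%MM]_(u <- s) u.

Definition in_lcm I (m : 'X_{1..n}) : Prop :=
  exists2 s, {in s, forall u, min_gen I u} & m = biglcm s.

End MonomialIdeals.

Section LcmLattice.
Variables (k : fieldType) (n : nat) (gens : seq 'X_{1..n}).

Let I := monomial_ideal (k := k) gens.

(* The LCM lattice of the ideal generated by [gens], under divisibility. The
   field [k] and the list [gens] only enter through the ideal. *)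
Record lcm_lattice : predArgType :=
  LcmLattice { lcm_mon :> 'X_{1..n}; _ : `[< in_lcm I lcm_mon >] }.

HB.instance Definition _ := [isSub for lcm_mon].
HB.instance Definition _ := [Choice of lcm_lattice by <:].

Lemma lcm_latticeP (x : lcm_lattice) : in_lcm I x.
Proof. by apply/asboolP; case: x. Qed.

Lemma biglcm_leP (s : seq 'X_{1..n}) (m : 'X_{1..n}) :
  reflect {in s, forall u, (u <= m)%MM} (biglcm s <= m)%MM.
Proof.
elim: s => [|v s IHs]; rewrite /biglcm ?big_nil ?big_cons.
  by apply: (iffP idP) => // _; apply/mnm_lepP => i; rewrite mnm0E.
rewrite lem_mlcm; apply: (iffP andP) => [[vm /IHs sm] u | sm].
  by rewrite inE => /predU1P[->|/sm].
split; first exact/sm/mem_head.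
by apply/IHs => u us; apply: sm; rewrite inE us orbT.
Qed.

Lemma mem_biglcm (s : seq 'X_{1..n}) (u : 'X_{1..n}) :
  u \in s -> (u <= biglcm s)%MM.
Proof. by move: u; apply/biglcm_leP/lepm_refl. Qed.

Lemma lepm_anti (u v : 'X_{1..n}) : (u <= v)%MM -> (v <= u)%MM -> u = v.
Proof.
move=> /mnm_lepP uv /mnm_lepP vu; apply/mnmP => i.
by apply/eqP; rewrite eqn_leq uv vu.
Qed.

Lemma monomial_ideal_mem (u : 'X_{1..n}) : u \in gens -> I 'X_[u].
Proof.
move=> us; have lt_u : (index u gens < size gens)%N by rewrite index_mem.
exists (fun i => (i == index u gens)%:R).
rewrite (bigD1 (Ordinal lt_u)) //= eqxx mul1r nth_index // big1 ?addr0 // => i.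
by rewrite -val_eqE /= => /negPf->; rewrite mul0r.
Qed.

Lemma monomial_ideal_div (m : 'X_{1..n}) :
  I 'X_[m] -> exists2 u, u \in gens & (u <= m)%MM.
Proof.
case=> c /(congr1 (mcoeff m)); rewrite mcoeffX eqxx raddf_sum /=.
have [/hasP[u us um] _|/hasPn ndiv] := boolP (has (fun u => (u <= m)%MM) gens).
  by exists u.
rewrite big1 => [/esym/eqP|i _]; first by rewrite eq_sym oner_eq0.
apply/eqP; rewrite mcoeff_eq0; apply/negP => /msuppM_le /allpairsP /=.
case=> -[u v] /= [_]; rewrite msuppX inE => /eqP-> def_m.
have /negP[] := ndiv _ (mem_nth 0%MM (ltn_ord i)).
by rewrite def_m lem_addl.
Qed.

Lemma min_gen_mem (u : 'X_{1..n}) : min_gen I u -> u \in gens.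
Proof.
case=> /monomial_ideal_div[v vs vu] umin.
by rewrite -(umin v (monomial_ideal_mem vs) vu).
Qed.

Fact lcm_display : Order.disp_t. Proof. exact: Order.Disp tt tt. Qed.

Definition lcm_le (x y : lcm_lattice) : bool := (x <= y)%MM.

Fact lcm_le_refl : reflexive lcm_le.
Proof. by move=> x; apply: lepm_refl. Qed.

Fact lcm_le_anti : antisymmetric lcm_le.
Proof. by move=> x y /andP[xy yx]; apply/val_inj/lepm_anti. Qed.

Fact lcm_le_trans : transitive lcm_le.
Proof. by move=> y x z; apply: lepm_trans. Qed.

HB.instance Definition _ := Order.Le_isPOrder.Build lcm_display lcm_lattice
  lcm_le_refl lcm_le_anti lcm_le_trans.

Fact lcm_join_subproof (x y : lcm_lattice) : `[< in_lcm I (mlcm x y) >].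
Proof.
apply/asboolP; have [s sI xE] := lcm_latticeP x.
have [t tI yE] := lcm_latticeP y.
exists (s ++ t) => [u|]; first by rewrite mem_cat => /orP[/sI|/tI].
apply: lepm_anti.
  rewrite lem_mlcm xE yE; apply/andP; split; apply/biglcm_leP => u us;
  by apply: mem_biglcm; rewrite mem_cat us ?orbT.
apply/biglcm_leP => u; rewrite mem_cat => /orP[] us.
  apply: lepm_trans (lem_mlcml _ _); rewrite xE; exact: mem_biglcm.
by apply: lepm_trans (lem_mlcmr _ _); rewrite yE; exact: mem_biglcm.
Qed.

Definition lcm_join (x y : lcm_lattice) : lcm_lattice :=
  LcmLattice (lcm_join_subproof x y).

(* The gcd of two elements need not lie in the lattice: their meet is the lcm
   of the minimal generators dividing both. *)
Definition common_gens (x y : lcm_lattice) : seq 'X_{1..n} :=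
  [seq u <- gens | `[< min_gen I u >] && ((u <= x)%MM && (u <= y)%MM)].

Fact lcm_meet_subproof (x y : lcm_lattice) :
  `[< in_lcm I (biglcm (common_gens x y)) >].
Proof.
apply/asboolP; exists (common_gens x y) => // u.
by rewrite mem_filter => /andP[/andP[/asboolP]].
Qed.

Definition lcm_meet (x y : lcm_lattice) : lcm_lattice :=
  LcmLattice (lcm_meet_subproof x y).

Fact lcm_meetP (x y z : lcm_lattice) :
  (x <= lcm_meet y z)%O = (x <= y)%O && (x <= z)%O.
Proof.
apply/idP/andP => [xm|[xy xz]].
  have myz v : (v \in [:: y; z]) -> (lcm_meet y z <= v)%O.
    move=> vyz; apply/biglcm_leP => u.
    rewrite mem_filter => /andP[/andP[_ /andP[uy uz]] _].
    by move: vyz; rewrite !inE => /orP[] /eqP->.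
  by split; apply: le_trans xm (myz _ _); rewrite !inE eqxx ?orbT.
have [s sI xE] := lcm_latticeP x; rewrite [X in is_true X]/(lcm_le _ _) /lcm_le.
have sx u : u \in s -> (u <= x)%MM by rewrite xE; apply: mem_biglcm.
rewrite [X in (X <= _)%MM]xE; apply/biglcm_leP => u us; apply: mem_biglcm.
rewrite mem_filter (min_gen_mem (sI u us)) (lepm_trans (sx u us) xy).
by rewrite (lepm_trans (sx u us) xz) !andbT; apply/asboolP/sI.
Qed.

Fact lcm_joinP (x y z : lcm_lattice) :
  (lcm_join x y <= z)%O = (x <= z)%O && (y <= z)%O.
Proof. exact: lem_mlcm. Qed.

HB.instance Definition _ :=
  Order.POrder_MeetJoin_isLattice.Build lcm_display lcm_lattice
    lcm_meetP lcm_joinP.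

Fact lcm_bot_subproof : `[< in_lcm I 0%MM >].
Proof. by apply/asboolP; exists [::]; rewrite ?/biglcm ?big_nil. Qed.

Fact lcm_top_subproof :
  `[< in_lcm I (biglcm [seq u <- gens | `[< min_gen I u >]]) >].
Proof.
apply/asboolP; exists [seq u <- gens | `[< min_gen I u >]] => // u.
by rewrite mem_filter => /andP[/asboolP].
Qed.

Fact lcm_le0x (x : lcm_lattice) : (LcmLattice lcm_bot_subproof <= x)%O.
Proof. by apply/mnm_lepP => i; rewrite mnm0E. Qed.

Fact lcm_lex1 (x : lcm_lattice) : (x <= LcmLattice lcm_top_subproof)%O.
Proof.
have [s sI xE] := lcm_latticeP x; rewrite [X in is_true X]/(lcm_le _ _) /lcm_le.
rewrite xE; apply/biglcm_leP => u us; apply: mem_biglcm.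
by rewrite mem_filter (min_gen_mem (sI u us)) andbT; apply/asboolP/sI.
Qed.

HB.instance Definition _ :=
  Order.hasBottom.Build lcm_display lcm_lattice lcm_le0x.
HB.instance Definition _ :=
  Order.hasTop.Build lcm_display lcm_lattice lcm_lex1.

Let code (x : lcm_lattice) : {set 'I_(size gens)} :=
  [set i : 'I_(size gens) | (nth 0%MM gens i <= x)%MM].

Let code_inj : injective code.
Proof.
suff codeS x y : code x = code y -> (x <= y)%O.
  by move=> x y xy; apply/le_anti; rewrite !codeS.
move=> xy; have [s sI xE] := lcm_latticeP x.
rewrite [X in is_true X]/(lcm_le _ _) /lcm_le [X in (X <= _)%MM]xE.
apply/biglcm_leP => u us; have ug := min_gen_mem (sI u us).
have lt_u : (index u gens < size gens)%N by rewrite index_mem.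
have: Ordinal lt_u \in code x.
  by rewrite inE /= nth_index // xE; apply: mem_biglcm.
by rewrite xy inE /= nth_index.
Qed.

Let decode (A : {set 'I_(size gens)}) : option lcm_lattice :=
  if pselect (exists x, code x = A) is left ex then Some (sval (cid ex))
  else None.

Let codeK : pcancel code decode.
Proof.
move=> x; rewrite /decode; case: pselect => [ex|[]]; last by exists x.
by congr Some; apply/code_inj; rewrite (svalP (cid ex)).
Qed.

HB.instance Definition _ := [Countable of lcm_lattice by <:].
HB.instance Definition _ : isFinite lcm_lattice := PCanIsFinite codeK.

End LcmLattice.

Section Graphs.

Definition edge_monomials (n : nat) (e : rel 'I_n) : seq 'X_{1..n} :=
  [seq (U_(ij.1) + U_(ij.2))%MM | ij <- enum {: 'I_n * 'I_n} & e ij.1 ij.2].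

Definition edge_lcm_lattice (k : fieldType) (n : nat) (e : rel 'I_n) :
    finTBLatticeType lcm_display :=
  lcm_lattice k (edge_monomials e).

Definition has_disjoint_edges (T : finType) (e : rel T) : Prop :=
  exists a b c d : T,
    [/\ e a b, e c d & [disjoint [set a; b] & [set c; d]]].

Definition graph_iso (T U : finType) (e : rel T) (f : rel U) : Prop :=
  exists2 h : T -> U, bijective h & forall x y, f (h x) (h y) = e x y.

Definition cycle3 : rel 'I_3 :=
  fun i j => (j == i.+1 %% 3 :> nat)%N || (i == j.+1 %% 3 :> nat)%N.

(* Vertex 1 of the star is [0 : 'I_n]. *)
Definition star (n : nat) : rel 'I_n :=
  fun i j => ((i == 0 :> nat) && (0 < j))%N || ((j == 0 :> nat) && (0 < i))%N.

End Graphs.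

(* Main.v *)
(* An element of the lcm lattice is squarefree, so it is determined by its
   support, and the supports are exactly the vertex sets that are unions of
   edges. Atoms are the edges. In a connected graph two disjoint edges yield a
   path a-b-c-d; then 1 < ab < abc < abcd is a chain although abcd is the join
   of two atoms, which contradicts semimodularity. Conversely, when any two
   edges meet, the intersection of two supports is again a union of edges as
   soon as it has two elements, and two nonempty supports always intersect.
   Hence |support| - 1 (and 0 at the bottom) is a modular rank function. *)
Require Import Defs.
From mathcomp Require Import boolp mpoly.
From mathcomp Require Import all_boot all_order all_algebra perm zify.

Set Implicit Arguments.
Unset Strict Implicit.
Unset Printing Implicit Defensive.

Import Order.TTheory GRing.Theory Num.Theory.

(** * Connected graphs without two disjoint edges *)

Section Graphs.
Variables (T : finType) (e : rel T).
Hypotheses (e_sym : symmetric e) (e_irr : irreflexive e).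

Lemma edges_meet a b c d : ~ has_disjoint_edges e ->
  e a b -> e c d -> [|| c == a, c == b, d == a | d == b].
Proof.
move=> no_disj eab ecd; apply/negPn/negP; rewrite !negb_or => /and4P[ca cb da db].
apply: no_disj; exists a, b, c, d; split=> //.
rewrite disjoint_subset; apply/subsetP => w; rewrite !inE negb_or.
by case/orP => /eqP->; rewrite ![_ == c]eq_sym ![_ == d]eq_sym ?ca ?cb ?da ?db.
Qed.

(** Walk from [a] towards [c], keeping an edge that avoids [c] and [d] and has the current vertex as
    one end. The step that first enters [{c, d}] links this edge to [cd], which yields the path. *)
Lemma connected_disjoint_edges_path4 : (forall u v, connect e u v) ->
  has_disjoint_edges e ->
  exists a b c d : T, [/\ e a b, e b c, e c d & uniq [:: a; b; c; d]].
Proof.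
move=> e_conn [a [b [c [d [eab ecd disj]]]]].
have ncd : c != d by apply: contraTneq ecd => ->; rewrite e_irr.
have /connectP[p ep lastp] := e_conn a c.
have : (a \notin [set c; d]) && (b \notin [set c; d]).
  move: disj; rewrite disjoint_subset => /subsetP sub.
  by rewrite [_ \notin _](sub a) ?[_ \notin _](sub b) ?set21 ?set22.
elim: p a b eab {disj} ep lastp => [|z p IHp] x y exy /=.
  by move=> _ ->; rewrite set21.
case/andP=> exz ep lastp /andP[xcd ycd].
have [zcd|zcd] := boolP (z \in [set c; d]); last first.
  by apply: (IHp z x) => //; rewrite ?zcd // e_sym.
have nxy : x != y by apply: contraTneq exy => ->; rewrite e_irr.
move: zcd xcd ycd; rewrite !inE !negb_or => /orP[] /eqP zE /andP[xc xd] /andP[yc yd].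
  exists y, x, c, d; rewrite e_sym exy -zE exz zE; split=> //=.
  by rewrite !inE !negb_or eq_sym nxy yc yd xc xd ncd.
exists y, x, d, c; rewrite e_sym exy -zE exz zE e_sym; split=> //=.
by rewrite !inE !negb_or eq_sym nxy yc yd xc xd eq_sym ncd.
Qed.

Lemma graph_iso_no_disjoint_edges (U : finType) (f : rel U) :
  graph_iso e f -> ~ has_disjoint_edges f -> ~ has_disjoint_edges e.
Proof.
case=> h [g hK gK] hE nf [a [b [c [d [eab ecd disj]]]]]; apply: nf.
exists (h a), (h b), (h c), (h d); rewrite !hE; split=> //.
by rewrite -!imset_set1 -!imsetU imset_disjoint //; apply: can_inj hK.
Qed.

(** If some vertex lies on all edges, the graph is a star around it. Otherwise an edge avoiding [a]
    meets [ab] in [b], so it is some [bc]; an edge avoiding [b] must then be [ac]. An edge at a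
    fourth vertex could not meet all three sides of this triangle. *)
Lemma no_disjoint_edges_star_or_triangle :
  (forall u v, connect e u v) -> (exists u v, e u v) -> ~ has_disjoint_edges e ->
  (exists v, forall x y, e x y = ((x == v) && (y != v)) || ((y == v) && (x != v)))
  \/ exists a b c : T, [/\ uniq [:: a; b; c], forall x, x \in [:: a; b; c]
                   & forall x y, e x y = (x != y)].
Proof.
move=> e_conn [a [b eab]] nd.
have edge_at x y : x != y -> exists z, e x z.
  have /connectP[[|z p] /=] := e_conn x y; first by move=> _ ->; rewrite eqxx.
  by case/andP => exz _ _ _; exists z.
have ne x y : e x y -> x != y by move=> exy; apply: contraTneq exy => ->; rewrite e_irr.
(* By connectedness every vertex other than [v] has an edge, and that edge can only end at [v]. *)
have center v : (forall x y, e x y -> (x == v) || (y == v)) ->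
    forall x y, e x y = ((x == v) && (y != v)) || ((y == v) && (x != v)).
  move=> vP; have vE x : x != v -> e x v.
    move=> xv; have [z exz] := edge_at x v xv.
    by have := vP _ _ exz; rewrite (negPf xv) => /eqP <-.
  move=> x y; have [->|xv] := eqVneq x v; have [->|yv] //= := eqVneq y v.
  - by rewrite e_sym vE.
  - exact: vE.
  by apply/negP => /vP; rewrite (negPf xv) (negPf yv).
have [[u uP]|noc] := pselect (exists v, forall x y, e x y -> (x == v) || (y == v)).
  by left; exists u; apply: center.
right.
have off v : exists x y, [/\ e x y, x != v & y != v].
  apply: contrapT => nv; apply: noc; exists v => x y exy.
  apply/negPn/negP; rewrite negb_or => /andP[xv yv]; apply: nv.
  by exists x, y.
have nab := ne _ _ eab.
have [c [ebc ca cb]] : exists c, [/\ e b c, c != a & c != b].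
  have [x [y [exy xa ya]]] := off a; have nxy := ne _ _ exy.
  have := edges_meet nd eab exy.
  rewrite (negPf xa) (negPf ya) /= => /orP[] /eqP E; subst.
    by exists y; split; rewrite // eq_sym.
  by exists x; split; rewrite // e_sym.
have eac : e a c.
  have [x [y [exy xb yb]]] := off b.
  have := edges_meet nd eab exy; have := edges_meet nd ebc exy.
  rewrite (negPf xb) (negPf yb) /= orbF => /orP[] /eqP E; subst; rewrite ?(negPf ca) /=.
    by move/eqP => <-; rewrite e_sym.
  by rewrite orbF => /eqP <-.
have ac : a != c by rewrite eq_sym.
have bc : b != c by rewrite eq_sym.
have all3 x : x \in [:: a; b; c].
  rewrite !inE; have [//|xa] := eqVneq x a; have [y exy] := edge_at x a xa.
  have := edges_meet nd eab exy; have := edges_meet nd ebc exy; have := edges_meet nd eac exy.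
  rewrite (negPf xa) /=; case: (x == b) => //=; case: (x == c) => //=.
  case/orP => /eqP->; first by rewrite (negPf nab) (negPf ac).
  by rewrite (negPf ca) (negPf cb).
exists a, b, c; split=> //; first by rewrite /= !inE negb_or nab ac bc.
move=> x y; have [->|nxy] := eqVneq x y; first by rewrite e_irr.
move: nxy (all3 x) (all3 y); rewrite !inE => nxy.
by case/or3P => /eqP E /or3P[] /eqP E'; subst; rewrite ?eqxx // in nxy *; rewrite // e_sym.
Qed.

Lemma triangle_iso (a b c : T) : uniq [:: a; b; c] -> (forall x, x \in [:: a; b; c]) ->
  (forall x y, e x y = (x != y)) -> graph_iso e cycle3.
Proof.
move=> abc_uniq all3 eE.
have lt3 x : index x [:: a; b; c] < 3 by rewrite -[3]/(size [:: a; b; c]) index_mem.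
have hK : cancel (fun x => Ordinal (lt3 x)) (fun i : 'I_3 => nth a [:: a; b; c] i).
  by move=> x; rewrite /= nth_index.
exists (fun x => Ordinal (lt3 x)).
  exists (fun i : 'I_3 => nth a [:: a; b; c] i) => // i.
  by apply: val_inj; apply: index_uniq.
(* [cycle3] joins any two distinct elements of ['I_3], which is checked pair by pair. *)
move=> x y; rewrite eE -(can_eq hK).
by case: (Ordinal (lt3 x)) (Ordinal (lt3 y)) => [[|[|[|//]]] ?] [[|[|[|//]]] ?].
Qed.

Lemma cycle3_no_disjoint_edges : ~ has_disjoint_edges cycle3.
Proof.
case=> a [b [c [d [/= eab ecd]]]]; rewrite disjoint_subset => /subsetP sub.
have := sub a (set21 _ _); have := sub b (set22 _ _); move: eab ecd; rewrite !inE {sub}.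
by case: a b c d => [[|[|[|//]]] ?] [[|[|[|//]]] ?] [[|[|[|//]]] ?] [[|[|[|//]]] ?].
Qed.

Lemma star_no_disjoint_edges m : ~ has_disjoint_edges (@star m).
Proof.
case=> a [b [c [d [/= eab ecd]]]]; rewrite disjoint_subset => /subsetP sub.
have := sub a (set21 _ _); have := sub b (set22 _ _); move: eab ecd; rewrite !inE {sub}.
rewrite /star -!val_eqE /=; lia.
Qed.

End Graphs.

(** The transposition of [v] and [0] carries [v] to the centre of [star n]; the two ends of an edge
    give [2 <= n]. *)
Lemma center_star_iso n (e : rel 'I_n) v : (exists i j, e i j) ->
  (forall x y, e x y = ((x == v) && (y != v)) || ((y == v) && (x != v))) ->
  exists2 m, 2 <= m & graph_iso e (@star m).
Proof.
move=> [i [j eij]] eE; exists n.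
  have : i != j by apply: contraTneq eij => ->; rewrite eE andbN.
  by rewrite -val_eqE /=; have := ltn_ord i; have := ltn_ord j; lia.
have n0 : 0 < n by apply: leq_ltn_trans (ltn_ord v).
pose o : 'I_n := Ordinal n0.
exists (tperm v o); first by exists (tperm v o) => x; rewrite tpermK.
have tv x : (val (tperm v o x) == 0) = (x == v).
  by rewrite -[0]/(val o) val_eqE -(inj_eq (@perm_inj _ (tperm v o))) tpermL.
by move=> x y; rewrite /star !lt0n [in RHS]eE -!tv.
Qed.

(** Monotonicity of [rk] is only weak; strictness comes from covers: some [z <= y] covers [x], so
    [rk x + 1 = rk z <= rk y]. *)
Lemma rank_lt (d : Order.disp_t) (L : finTBLatticeType d) (rk : L -> int) :
  is_rank rk -> forall x y : L, (x < y)%O -> (rk x < rk y)%R.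
Proof.
case=> rk_le _ rk_cov x y xy.
pose P z := (x < z <= y)%O.
have Py : P y by rewrite /P xy lexx.
(* The number of elements strictly below [z] grows along [<], so a minimiser among the [z] with
   [x < z <= y] has nothing between [x] and itself. *)
case: (arg_minnP (fun z => #|[set t : L | (t < z)%O]|) Py) => z /andP[xz zy] zmin.
have /rk_cov rkz : covers x z.
  split=> // w; apply/negP => /andP[xw wz].
  have := zmin w; rewrite /P xw (le_trans (ltW wz) zy) leqNgt => /(_ isT)/negP.
  apply; apply: proper_card; apply/properP; split.
    by apply/subsetP => t; rewrite !inE => /lt_trans; apply.
  by exists w; rewrite !inE ?wz ?ltxx.
by apply: lt_le_trans (rk_le _ _ zy); rewrite rkz ltrDl.
Qed.

(** * The LCM lattice of an edge ideal as a lattice of vertex sets *)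

Section EdgeLcmLattice.
Variables (k : fieldType) (n : nat) (e : rel 'I_n).
Hypotheses (e_sym : symmetric e) (e_irr : irreflexive e).

Let L := edge_lcm_lattice k e.
Implicit Types (x y z : L) (u v w : 'I_n) (S T : {set 'I_n}).

Definition lcm_supp x : {set 'I_n} := [set i | lcm_mon x i != 0].

(** These sets are the unions of edges, the empty union included: no vertex of [S] is isolated in
    the subgraph induced on [S]. *)
Definition edge_covered S : Prop := forall u, u \in S -> exists2 v, v \in S & e u v.

Lemma biglcm_neq0 (s : seq 'X_{1..n}) (i : 'I_n) :
  (biglcm s i != 0) = has (fun m : 'X_{1..n} => m i != 0) s.
Proof.
elim: s => [|m s IHs]; rewrite /biglcm ?big_nil ?big_cons ?mnm0E //=.
by rewrite -IHs mlcmE mnmDE mnmBE /biglcm; lia.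
Qed.

Lemma edge_monomialsP (m : 'X_{1..n}) :
  reflect (exists u v, e u v /\ m = (U_(u) + U_(v))%MM)
          (m \in edge_monomials e).
Proof.
apply: (iffP mapP) => [[[u v]]|[u [v [euv ->]]]].
  by rewrite mem_filter /= => /andP[euv _ ->]; exists u, v.
by exists (u, v); rewrite // mem_filter euv mem_enum.
Qed.

(** All edge monomials have degree 2. A monomial of the ideal dividing [m] is itself divisible by
    some edge monomial [m''], and equal degrees force [m = m'']. *)
Lemma edge_monomials_min_gen (m : 'X_{1..n}) :
  m \in edge_monomials e -> min_gen (monomial_ideal (k := k) (edge_monomials e)) m.
Proof.
move=> me; split=> [|m' /monomial_ideal_div[m'' m''e le''] le'].
  exact: monomial_ideal_mem.
have [u [v [_ mE]]] := edge_monomialsP _ me.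
have [u' [v' [_ mE']]] := edge_monomialsP _ m''e.
have degE : mdeg m = mdeg m'' by rewrite mE mE' !mdegD !mdeg1.
suff em : m = m'' by apply: lepm_anti; rewrite // em.
have /submK mB := lepm_trans le'' le'.
have : mdeg (m - m'')%MM = 0.
  by apply/eqP; rewrite -(eqn_add2r (mdeg m'')) -mdegD mB degE.
by move/eqP; rewrite mdeg_eq0 => /eqP m0; rewrite -mB m0 add0m.
Qed.

Lemma edge_monomialE u v i : e u v -> (U_(u) + U_(v))%MM i = (i \in [set u; v]).
Proof.
move=> euv; rewrite mnmDE !mnm1E !inE ![i == _]eq_sym.
by case: eqP euv => [->|]; case: eqP => [->|] //; rewrite e_irr.
Qed.

Lemma lcm_mon_supp x : lcm_mon x = [multinom nat_of_bool (i \in lcm_supp x) | i < n].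
Proof.
apply/mnmP => i; rewrite mnmE inE.
have [s sI ->] := lcm_latticeP x.
suff: biglcm s i <= 1 by lia.
(* Every edge monomial divides the product of all variables, hence so does their lcm, which is
   therefore squarefree. *)
have /mnm_lepP/(_ i) : (biglcm s <= [multinom 1 | i < n])%MM.
  apply/biglcm_leP => m /sI/min_gen_mem/edge_monomialsP[u [v [euv ->]]].
  by apply/mnm_lepP => j; rewrite edge_monomialE // mnmE leq_b1.
by rewrite mnmE.
Qed.

Lemma lcm_supp_sub x y : (lcm_supp x \subset lcm_supp y) = (x <= y)%O.
Proof.
rewrite [RHS]/(lcm_le _ _) /lcm_le; apply/subsetP/mnm_lepP => [sxy i|le_xy i].
  by rewrite !lcm_mon_supp !mnmE; have := sxy i; case: (i \in lcm_supp x) => // ->.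
by rewrite !inE -!lt0n => /leq_trans; apply.
Qed.

Lemma lcm_supp_inj : injective lcm_supp.
Proof. by move=> x y xy; apply/le_anti; rewrite -!lcm_supp_sub xy subxx. Qed.

Lemma lcm_supp_proper x y : (lcm_supp x \proper lcm_supp y) = (x < y)%O.
Proof. by rewrite properE !lcm_supp_sub lt_leAnge. Qed.

Lemma lcm_supp_covered x : edge_covered (lcm_supp x).
Proof.
move=> u; rewrite inE; have [s sI xE] := lcm_latticeP x.
rewrite xE biglcm_neq0 => /hasP[m ms]; have me := min_gen_mem (sI m ms).
have [a [b [eab mE]]] := edge_monomialsP _ me.
have Sab w : w \in [set a; b] -> w \in lcm_supp x.
  move=> wab; rewrite inE xE biglcm_neq0; apply/hasP; exists m => //.
  by rewrite mE edge_monomialE // wab.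
rewrite mE edge_monomialE // eqb0 negbK !inE => /orP[] /eqP->.
  by exists b; rewrite ?Sab ?set22.
by exists a; rewrite ?Sab ?set21 // e_sym.
Qed.

(** The witness is the lcm of the monomials of all edges lying inside [S]. *)
Lemma edge_covered_supp S : edge_covered S -> exists x, lcm_supp x = S.
Proof.
move=> covS.
pose s := [seq (U_(ij.1) + U_(ij.2))%MM | ij <- enum {: 'I_n * 'I_n}
  & [&& e ij.1 ij.2, ij.1 \in S & ij.2 \in S]].
have sP m : m \in s -> exists u v, [/\ e u v, u \in S, v \in S & m = (U_(u) + U_(v))%MM].
  by case/mapP => -[u v]; rewrite mem_filter /= => /andP[/and3P[? ? ?] _ ->]; exists u, v.
have sI : `[< in_lcm (monomial_ideal (k := k) (edge_monomials e)) (biglcm s) >].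
  apply/asboolP; exists s => // m /sP[u [v [euv _ _ ->]]].
  by apply/edge_monomials_min_gen/edge_monomialsP; exists u, v.
exists (LcmLattice sI); apply/setP => i; rewrite inE /= biglcm_neq0.
apply/hasP/idP => [[m /sP[u [v [euv uS vS ->]]]]|iS].
  by rewrite edge_monomialE // eqb0 negbK !inE => /orP[] /eqP->.
have [v vS eiv] := covS i iS; exists (U_(i) + U_(v))%MM.
  by apply/mapP; exists (i, v); rewrite // mem_filter /= eiv iS vS mem_enum.
by rewrite edge_monomialE // set21.
Qed.

Lemma edge_covered_edge u v : e u v -> edge_covered [set u; v].
Proof.
move=> euv w; rewrite !inE => /orP[] /eqP->.
  by exists v; rewrite ?set22.
by exists u; rewrite ?set21 // e_sym.
Qed.

Lemma edge_coveredU S T : edge_covered S -> edge_covered T -> edge_covered (S :|: T).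
Proof.
move=> cS cT u; rewrite inE => /orP[/cS|/cT] [v vS euv]; exists v => //.
  by rewrite inE vS.
by rewrite inE vS orbT.
Qed.

Lemma lcm_supp0 : lcm_supp (\bot%O : L) = set0.
Proof. by apply/setP => i; rewrite !inE /= mnm0E. Qed.

(** Only joins are computed on supports this simply: two edges sharing exactly one vertex meet in
    the bottom, whose support is smaller than the intersection. *)
Lemma lcm_suppU x y : lcm_supp (x `|` y)%O = lcm_supp x :|: lcm_supp y.
Proof. by apply/setP => i; rewrite !inE /= mlcmE mnmDE mnmBE; lia. Qed.

Lemma lcm_supp_eq0 x : (lcm_supp x == set0) = (x == \bot%O).
Proof. by rewrite -lcm_supp0 (inj_eq lcm_supp_inj). Qed.

(** The support of a nonzero element contains an edge, hence two vertices, and cannot be a proper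
    subset of a pair. *)
Lemma edge_atom x u v : e u v -> lcm_supp x = [set u; v] -> atom x.
Proof.
move=> euv xE; split=> [|z].
  by rewrite lt0x -lcm_supp_eq0 xE; apply/set0Pn; exists u; apply: set21.
apply/negP => /andP[]; rewrite lt0x -lcm_supp_eq0 => /set0Pn[a az].
rewrite -lcm_supp_proper => /proper_card; apply/negP; rewrite -leqNgt xE cards2.
have [b bz eab] := lcm_supp_covered az.
have neq_ab : a != b by apply: contraTneq eab => ->; rewrite e_irr.
apply: leq_trans (_ : #|[set a; b]| <= _).
  by rewrite cards2 neq_ab; case: (u != v).
by apply: subset_leq_card; rewrite subUset !sub1set az.
Qed.

(** Each vertex of the support of [x] lies on an edge inside that support, so [x] is the join of the
    atoms below it. *)
Lemma edge_lcm_lattice_atomic : atomic L.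
Proof.
move=> x; exists [seq a <- enum L | `[< atom a >] && (a <= x)%O].
  by move=> a; rewrite mem_filter => /andP[/andP[/asboolP]].
apply/le_anti/andP; split; last first.
  by apply/joinsP_seq => a; rewrite mem_filter => /andP[/andP[]].
rewrite -lcm_supp_sub; apply/subsetP => u ux.
have [v vx euv] := lcm_supp_covered ux.
have [a aE] := edge_covered_supp (edge_covered_edge euv).
have ua : u \in lcm_supp a by rewrite aE set21.
apply: (subsetP _ _ ua); rewrite lcm_supp_sub; apply: joins_sup_seq => //.
rewrite mem_filter mem_enum andbT -lcm_supp_sub aE.
by rewrite (asboolT (edge_atom euv aE)) subUset !sub1set ux.
Qed.

(** With supports [ab], [cd] and [abc] for [x], [y] and [z], the chain [x < z < x \/ y] gives the
    join rank at least 3, while semimodularity allows at most [1 + 1]. *)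
Lemma upper_semimodular_no_path4 a b c d : upper_semimodular L ->
  e a b -> e b c -> e c d -> uniq [:: a; b; c; d] -> False.
Proof.
case=> rk rk_rank rk_sm eab ebc ecd; have rk_lt := rank_lt rk_rank.
rewrite /= !inE !negb_or => /and4P[/and3P[ab ac ad] /andP[bc bd] cd _].
have [x xE] := edge_covered_supp (edge_covered_edge eab).
have [y yE] := edge_covered_supp (edge_covered_edge ecd).
have [z zE] := edge_covered_supp
  (edge_coveredU (edge_covered_edge eab) (edge_covered_edge ebc)).
have [_ rk0 rkC] := rk_rank.
have rkx : rk x = 1%R by rewrite (rkC _ _ (edge_atom eab xE)) rk0 add0r.
have rky : rk y = 1%R by rewrite (rkC _ _ (edge_atom ecd yE)) rk0 add0r.
have xz : (x < z)%O.
  rewrite -lcm_supp_proper xE zE; apply/properP; split; first exact: subsetUl.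
  by exists c; rewrite !inE ?eqxx ?orbT // negb_or eq_sym ac eq_sym bc.
have zxy : (z < x `|` y)%O.
  rewrite -lcm_supp_proper lcm_suppU xE yE zE; apply/properP; split.
    by apply/subsetP => w; rewrite !inE => /orP[] /orP[] /eqP->; rewrite eqxx ?orbT.
  exists d; rewrite !inE ?eqxx ?orbT // !negb_or.
  by rewrite ![d == _]eq_sym ad bd cd.
(* A lower bound on the rank of the meet is enough, so the meet is not computed. *)
have meet0 : (rk \bot%O <= rk (x `&` y)%O)%R.
  by case: rk_rank => rk_le _ _; apply: rk_le; apply: le0x.
have := rk_sm x y; have := rk_lt _ _ xz; have := rk_lt _ _ zxy; rewrite rk0 in meet0.
lia.
Qed.

(** * The modular rank function when any two edges meet *)

Section Modular.
Hypothesis no_disj : ~ has_disjoint_edges e.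

(** Given [w] and another common vertex [w'], an edge at [w] inside [S] meets an edge at [w'] inside
    [T]. Either this makes [w] and [w'] adjacent, or the far ends coincide and give a neighbour of
    [w] in both sets. *)
Lemma edge_coveredI S T : edge_covered S -> edge_covered T ->
  1 < #|S :&: T| -> edge_covered (S :&: T).
Proof.
move=> cS cT ST1 w /setIP[wS wT].
have [w' w'w /setIP[w'S w'T]] : exists2 w', w' != w & w' \in S :&: T.
  have [a [b [aST bST ab]]] := card_gt1P ST1.
  by have [aw|] := eqVneq a w; [exists b; rewrite // eq_sym -aw | exists a].
have done_ww' : e w w' -> exists2 v, v \in S :&: T & e w v.
  by exists w'; rewrite // inE w'S w'T.
have [s sS ews] := cS w wS; have [t' t'T ew't'] := cT w' w'T.
have := edges_meet no_disj ews ew't'; rewrite (negPf w'w) /=.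
case/or3P => /eqP E; first by apply: done_ww'; rewrite E.
  by apply: done_ww'; rewrite e_sym -E.
by exists s; rewrite // inE sS -E.
Qed.

Lemma supp_meet_nonempty x y : x != \bot%O -> y != \bot%O ->
  lcm_supp x :&: lcm_supp y != set0.
Proof.
rewrite -!lcm_supp_eq0 => /set0Pn[a ax] /set0Pn[c cy].
have [b bx eab] := lcm_supp_covered ax; have [d dy ecd] := lcm_supp_covered cy.
apply/set0Pn; have := edges_meet no_disj eab ecd.
by case/or4P => /eqP E; [exists c|exists c|exists d|exists d];
  rewrite inE ?cy ?dy E ?ax ?bx.
Qed.

(** Since [0.-1 = 0], the bottom gets rank 0, as do no other elements: a nonempty support has at
    least two vertices. *)
Definition supp_rank x : nat := #|lcm_supp x|.-1.

Lemma supp_rankI x y : x != \bot%O -> y != \bot%O ->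
  supp_rank (x `&` y)%O = #|lcm_supp x :&: lcm_supp y|.-1.
Proof.
move=> x0 y0; rewrite /supp_rank.
have subI : lcm_supp (x `&` y)%O \subset lcm_supp x :&: lcm_supp y.
  by rewrite subsetI !lcm_supp_sub leIl leIr.
(* With at most one common vertex, both truncated predecessors are 0; otherwise the intersection is
   itself the support of the meet. *)
have [le1|gt1] := leqP #|lcm_supp x :&: lcm_supp y| 1.
  by have := subset_leq_card subI; lia.
have [z zE] := edge_covered_supp
  (edge_coveredI (lcm_supp_covered (x := x)) (lcm_supp_covered (x := y)) gt1).
suff -> : lcm_supp (x `&` y)%O = lcm_supp z by rewrite zE.
apply/eqP; rewrite eqEsubset zE subI /= -zE lcm_supp_sub.
by rewrite lexI -!lcm_supp_sub zE subsetIl subsetIr.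
Qed.

(** An edge [wt] inside [y] with [w] outside [x] satisfies [y = x \/ wt] by the cover condition. For
    [x] the bottom this adds two vertices, giving rank 1; otherwise [wt] must meet an edge of [x],
    so [t] is already there and only [w] is new. *)
Lemma supp_rank_covers x y : covers x y -> supp_rank y = (supp_rank x).+1.
Proof.
case=> xy ycov; rewrite /supp_rank.
have xz_eq z : (x < z)%O -> (z <= y)%O -> z = y.
  move=> xz; rewrite le_eqVlt => /predU1P[//|zy].
  by have := ycov z; rewrite xz zy.
have /properP[sxy [w wy wx]] : lcm_supp x \proper lcm_supp y by rewrite lcm_supp_proper.
have [t ty ewt] := lcm_supp_covered wy.
have neq_wt : w != t by apply: contraTneq ewt => ->; rewrite e_irr.
have [z zE] := edge_covered_supp
  (edge_coveredU (lcm_supp_covered (x := x)) (edge_covered_edge ewt)).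
have <- : z = y.
  apply: xz_eq; rewrite -?lcm_supp_proper -?lcm_supp_sub zE.
    by apply/properP; split; [apply: subsetUl | exists w; rewrite // !inE eqxx orbT].
  by rewrite !subUset !sub1set sxy wy ty.
rewrite zE; have [->|[a ax]] := set_0Vmem (lcm_supp x).
  by rewrite set0U cards2 neq_wt cards0.
have tx : t \in lcm_supp x.
  have [b bx eab] := lcm_supp_covered ax.
  have := edges_meet no_disj eab ewt; case/or4P => /eqP E; move: wx ax bx; rewrite -?E //.
    by move=> /negPf->.
  by move=> /negPf->.
have -> : lcm_supp x :|: [set w; t] = w |: lcm_supp x.
  apply/setP => v; rewrite !in_setU !in_set1.
  by have [->|_] := eqVneq v t; [rewrite tx orbT | rewrite orbF orbC].
rewrite cardsU1 wx add1n prednK //.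
by apply/card_gt0P; exists a.
Qed.

Lemma no_disjoint_edges_modular : modular L.
Proof.
exists (fun x => Posz (supp_rank x)).
  split=> [x y|| x y /supp_rank_covers->]; last by lia.
    by rewrite -lcm_supp_sub => /subset_leq_card; rewrite /supp_rank; lia.
  by rewrite /supp_rank lcm_supp0 cards0.
(* The bottom is handled apart, its rank being 0 and not -1. For other elements the intersection is
   nonempty, so no predecessor truncates and the identity is inclusion-exclusion. *)
move=> x y; have [->|x0] := eqVneq x \bot%O; first by rewrite meet0x join0x.
have [->|y0] := eqVneq y \bot%O; first by rewrite meetx0 joinx0 addrC.
rewrite supp_rankI // /supp_rank lcm_suppU.
have := cardsUI (lcm_supp x) (lcm_supp y).
have := supp_meet_nonempty x0 y0; rewrite -card_gt0.
have := subset_leq_card (subsetIl (lcm_supp x) (lcm_supp y)).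
have := subset_leq_card (subsetIr (lcm_supp x) (lcm_supp y)).
lia.
Qed.

End Modular.

End EdgeLcmLattice.

Theorem theorem6p3 (k : fieldType) (n : nat) (e : rel 'I_n)
    (e_sym : symmetric e) (e_irr : irreflexive e)
    (e_conn : forall i j : 'I_n, connect e i j)
    (e_nontriv : exists i j : 'I_n, e i j) :
  [<-> modular (edge_lcm_lattice k e);
       geometric (edge_lcm_lattice k e);
       upper_semimodular (edge_lcm_lattice k e);
       ~ has_disjoint_edges e;
       graph_iso e cycle3 \/
         exists2 m : nat, (2 <= m)%N & graph_iso e (@star m)].
Proof.
tfae.
- case=> rk rk_rank rk_mod; split; last exact: edge_lcm_lattice_atomic.
  by exists rk => // x y; rewrite -rk_mod.
- by case.
- move=> sm disj; have [a [b [c [d [eab ebc ecd abcd]]]]] :=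
    connected_disjoint_edges_path4 e_sym e_irr e_conn disj.
  exact: (upper_semimodular_no_path4 e_sym e_irr sm eab ebc ecd abcd).
- move=> no_disj.
  have [[v vE]|[a [b [c [abc_uniq abcT eE]]]]] :=
    no_disjoint_edges_star_or_triangle e_sym e_irr e_conn e_nontriv no_disj.
    by right; apply: center_star_iso vE.
  by left; apply: triangle_iso abc_uniq abcT eE.
(* The cycle closes through the absence of disjoint edges, which is pulled back along the
   isomorphism from the model graph. *)
- move=> iso; apply: no_disjoint_edges_modular => //.
  case: iso => [iso|[m _ iso]]; apply: graph_iso_no_disjoint_edges iso _.
    exact: cycle3_no_disjoint_edges.
  exact: star_no_disjoint_edges.
Qed.
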